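(* Let $G$ be a group acting on a topological space $X$, let $X/G$ be the orbit space with the identification topology, and let $p : X \to X/G$ be the quotient map. Assume: (i) $p$ has the path lifting property: if $\bar a : [0,1] \to X/G$ is a path, then there is a path $a : [0,1]\to X$ such that $p a = \bar a$. (ii) Every $x \in X$ has an open neighbourhood $U_x$ such that (a) if $g \in G$ does not belong to the stabiliser $G_x$ of $x$, then $U_x \cap (g\cdot U_x) = \emptyset$; (b) if $a$ and $b$ are paths in $U_x$ beginning at $x$ and such that $pa$ and $pb$ are homotopic rel end points in $X/G$, then there is an element $g \in G_x$ such that $g\cdot a$ and $b$ are homotopic in $X$ rel end points. Then the induced morphism of fundamental groupoids $p_* : \pi X \to \pi(X/G)$ makes $\pi(X/G)$ the orbit groupoid of $\pi X$ by the induced action of $G$; that is, $p_*$ is an orbit morphism.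
   Context: An action of a group $G$ on a topological space $X$ is a function $G\times X\to X$, $(g,x)\mapsto g\cdot x$, with $1\cdot x = x$ and $g\cdot(h\cdot x) = (gh)\cdot x$, such that for each $g\in G$ the map $x\mapsto g\cdot x$ is continuous (equivalently, the action map is continuous when $G$ is discrete). The stabiliser of $x$ is $G_x=\{g\in G: g\cdot x=x\}$. $X/G$ is the set of orbits. $\pi X$ denotes the fundamental groupoid of $X$ (objects: all points of $X$; arrows: homotopy classes rel end points of paths). An action of a group $G$ on a groupoid $\Gamma$ assigns to each $g\in G$ a groupoid morphism $g_\sharp:\Gamma\to\Gamma$ (written $g\cdot x$ on objects, $g\cdot\gamma$ on arrows) with $1_\sharp = \mathrm{id}$ and $(hg)_\sharp = h_\sharp g_\sharp$. If $G$ acts on $X$, it acts on $\pi X$ by the morphisms induced by the homeomorphisms $x\mapsto g\cdot x$. An orbit groupoid of an action of $G$ on a groupoid $\Gamma$ is a groupoid $\Gamma/\!/G$ together with a groupoid morphism $p:\Gamma\to\Gamma/\!/G$ (called an orbit morphism) such that (1) $p(g\cdot\gamma)=p(\gamma)$ for all $g\in G$, $\gamma\in\Gamma$ (objects and arrows); and (2) $p$ is universal for (1): if $\phi:\Gamma\to\Phi$ is a morphism of groupoids with $\phi(g\cdot\gamma)=\phi(\gamma)$ for all $g\in G,\gamma\in\Gamma$, then there is a unique groupoid morphism $\phi^*:\Gamma/\!/G\to\Phi$ with $\phi^* p=\phi$. *)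

(* Defs.v *)
From HB Require Import structures.
From mathcomp Require Import all_boot all_order all_algebra.
From mathcomp Require Import all_classical all_reals all_analysis.
From mathcomp Require Import homotopy.
From mathcomp Require Import ring lra.

Set Implicit Arguments.
Unset Strict Implicit.
Unset Printing Implicit Defensive.

Import Order.TTheory GRing.Theory Num.Theory.
Import numFieldNormedType.Exports.

Local Open Scope classical_set_scope.
Local Open Scope ring_scope.
Local Open Scope quotient_scope.

(* [set_type] carries the subspace topology. *)
Definition unit_interval (R : realType) : Type :=
  set_type (`[0, 1]%classic : set R).

Section UnitInterval.
Variable R : realType.
Local Notation I := (unit_interval R).

HB.instance Definition _ :=
  Topological.copy I (set_type (`[0, 1]%classic : set R)).

Lemma clamp_subproof (t : R) :
  Num.max 0 (Num.min 1 t) \in (`[0, 1]%classic : set R).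
Proof.
by apply/mem_set; rewrite /= in_itv /= le_max lexx /= ge_max ler01 /= ge_min lexx.
Qed.

Definition clamp (t : R) : I := SigSub (clamp_subproof t).
Definition uval (t : I) : R := set_val t.

Lemma uval_itv (t : I) : 0 <= uval t <= 1.
Proof. by case: t => t /= tI; move/set_mem: (tI); rewrite /= in_itv. Qed.

Lemma uval_inj : injective uval.
Proof. by move=> [s ?] [t ?]; rewrite /uval /= => st; exact: eq_sig_hprop. Qed.

Lemma clampE (t : R) : uval (clamp t) = Num.max 0 (Num.min 1 t).
Proof. by []. Qed.

Lemma clamp_id (t : R) : 0 <= t <= 1 -> uval (clamp t) = t.
Proof. by case/andP=> t0 t1; rewrite clampE min_r // max_r. Qed.

Lemma uvalK : cancel uval clamp.
Proof. by move=> t; apply: uval_inj; rewrite clamp_id // uval_itv. Qed.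

Lemma uval_continuous : continuous uval.
Proof. exact: initial_continuous. Qed.

Lemma clamp_continuous : continuous clamp.
Proof.
apply: continuous_comp_initial => t.
apply: (@continuous_max R R (fun=> 0) (fun t => Num.min 1 t)).
  exact: cvg_cst.
apply: (@continuous_min R R (fun=> 1) id); [exact: cvg_cst|exact: cvg_id].
Qed.

Lemma unit_interval_zero_neq_one : clamp 0 != clamp 1.
Proof.
apply/eqP => /(congr1 uval); rewrite !clamp_id ?lexx ?ler01 // => /esym/eqP.
by rewrite oner_eq0.
Qed.

HB.instance Definition _ := isBiPointed.Build I unit_interval_zero_neq_one.

Lemma uval0 : uval zero = 0.
Proof. by rewrite clamp_id ?lexx ?ler01. Qed.

Lemma uval1 : uval one = 1.
Proof. by rewrite clamp_id ?lexx ?ler01. Qed.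

Lemma clamp0 (t : R) : t <= 0 -> clamp t = zero.
Proof.
by move=> t0; apply: uval_inj; rewrite uval0 clampE min_r ?max_l //; lra.
Qed.

Lemma clamp1 (t : R) : 1 <= t -> clamp t = one.
Proof.
by move=> t1; apply: uval_inj; rewrite uval1 clampE min_l ?max_r //; lra.
Qed.
End UnitInterval.

Arguments uval {R} t.
Arguments clamp {R} t.

Section Pasting.
Variables (R : realType) (T X : topologicalType).

Lemma paste_continuous (u : T -> R) (c : R) (f g : T -> X) :
  continuous u -> continuous f -> continuous g ->
  (forall t, u t = c -> f t = g t) ->
  continuous (fun t => if u t <= c then f t else g t).
Proof.
move=> cu cf cg fg t U /=; case: (ltgtP (u t) c) => utc nU.
- have h1 : nbhs t [set s | u s < c] by exact: (cu t _ (lt_nbhsl utc)).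
  have h2 : nbhs t [set s | U (f s)] by exact: (cf t U nU).
  by apply: filterS (filterI h1 h2) => s [/= us ?]; rewrite ltW.
- have h1 : nbhs t [set s | c < u s] by exact: (cu t _ (lt_nbhsr utc)).
  have h2 : nbhs t [set s | U (g s)] by exact: (cg t U nU).
  by apply: filterS (filterI h1 h2) => s [/= us ?]; rewrite leNgt us.
- have h1 : nbhs t [set s | U (f s)] by exact: (cf t U nU).
  have h2 : nbhs t [set s | U (g s)] by apply: (cg t U); rewrite -(fg _ utc).
  by apply: filterS (filterI h1 h2) => s [/= ? ?]; case: ifP.
Qed.
End Pasting.

Section Homotopy.
Variables (R : realType).
Local Notation I := (unit_interval R).

(* Equality of the end points of f and g is forced by the last two clauses. *)
Definition homotopic_rel (X : topologicalType) (f g : I -> X) : Prop :=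
  exists H : I * I -> X,
    [/\ continuous H,
        forall t, H (t, zero) = f t /\ H (t, one) = g t,
        forall s, H (zero, s) = f zero &
        forall s, H (one, s) = f one].

Variable X : topologicalType.
Implicit Types f g h : I -> X.

Lemma homotopic_rel_ends f g :
  homotopic_rel f g -> f zero = g zero /\ f one = g one.
Proof.
case=> H [_ H01 H0 H1].
by rewrite -(H0 one) -(H1 one) (H01 zero).2 (H01 one).2.
Qed.

Lemma clamp_comp_continuous (T : topologicalType) (u : T -> R) :
  continuous u -> continuous (fun t => clamp (u t)).
Proof.
move=> cu t; apply: (@continuous_comp _ _ _ u clamp); first exact: cu.
exact: clamp_continuous.
Qed.

Lemma uval_comp_continuous (T : topologicalType) (u : T -> I) :
  continuous u -> continuous (fun t => uval (u t)).
Proof.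
move=> cu t; apply: (@continuous_comp _ _ _ u uval); first exact: cu.
exact: uval_continuous.
Qed.

Lemma fst_cont (S T : topologicalType) : continuous (@fst S T).
Proof. by move=> [s t]; exact: cvg_fst. Qed.

Lemma snd_cont (S T : topologicalType) : continuous (@snd S T).
Proof. by move=> [s t]; exact: cvg_snd. Qed.

Lemma pair_cont (S T U : topologicalType) (f : S -> T) (g : S -> U) :
  continuous f -> continuous g -> continuous (fun s => (f s, g s)).
Proof. by move=> cf cg s; apply: cvg_pair; [exact: cf|exact: cg]. Qed.

Lemma comp_cont (S T U : topologicalType) (g : T -> U) (f : S -> T) :
  continuous g -> continuous f -> continuous (fun s => g (f s)).
Proof. by move=> cg cf s; apply: continuous_comp; [exact: cf|exact: cg]. Qed.

Lemma addf_cont (T : topologicalType) (u v : T -> R) :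
  continuous u -> continuous v -> continuous (fun t => u t + v t).
Proof. by move=> cu cv t; apply: cvgD; [exact: cu|exact: cv]. Qed.

Lemma mulf_cont (T : topologicalType) (u v : T -> R) :
  continuous u -> continuous v -> continuous (fun t => u t * v t).
Proof. by move=> cu cv t; apply: cvgM; [exact: cu|exact: cv]. Qed.

Lemma oppf_cont (T : topologicalType) (u : T -> R) :
  continuous u -> continuous (fun t => - u t).
Proof. by move=> cu t; apply: cvgN; exact: cu. Qed.

Lemma cstf_cont (S T : topologicalType) (c : T) : continuous (fun _ : S => c).
Proof. by move=> t; exact: cvg_cst. Qed.

Lemma uval_fst_cont : continuous (fun p : I * I => uval p.1).
Proof. by apply: uval_comp_continuous; exact: fst_cont. Qed.

Lemma uval_snd_cont : continuous (fun p : I * I => uval p.2).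
Proof. by apply: uval_comp_continuous; exact: snd_cont. Qed.

Lemma homotopic_refl f : continuous f -> homotopic_rel f f.
Proof.
move=> cf; exists (fun p => f p.1); split=> //.
by apply: comp_cont => //; exact: fst_cont.
Qed.

Lemma homotopic_sym f g : homotopic_rel f g -> homotopic_rel g f.
Proof.
move=> fg; have [f0 f1] := homotopic_rel_ends fg.
case: fg => H [cH H01 H0 H1].
exists (fun p => H (p.1, clamp (1 - uval p.2))); split => /=.
- apply: comp_cont => //; apply: pair_cont; first exact: fst_cont.
  apply: clamp_comp_continuous; apply: addf_cont; first exact: cstf_cont.
  by apply: oppf_cont; exact: uval_snd_cont.
- move=> t; rewrite uval0 uval1 subr0 subrr (clamp0 (lexx 0)) (clamp1 (lexx 1)).
  by split; [exact: (H01 t).2|exact: (H01 t).1].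
- by move=> s; rewrite H0.
- by move=> s; rewrite H1.
Qed.

Lemma homotopic_trans f g h :
  homotopic_rel f g -> homotopic_rel g h -> homotopic_rel f h.
Proof.
move=> fg; have [f0 f1] := homotopic_rel_ends fg.
case: fg => H [cH H01 H0 H1] [K [cK K01 K0 K1]].
exists (fun p => if uval p.2 <= 2^-1 then H (p.1, clamp (2 * uval p.2))
                 else K (p.1, clamp (2 * uval p.2 - 1))); split => /=.
- apply: paste_continuous.
  + exact: uval_snd_cont.
  + apply: comp_cont => //; apply: pair_cont; first exact: fst_cont.
    apply: clamp_comp_continuous; apply: mulf_cont; first exact: cstf_cont.
    exact: uval_snd_cont.
  + apply: comp_cont => //; apply: pair_cont; first exact: fst_cont.
    apply: clamp_comp_continuous; apply: addf_cont; last exact: cstf_cont.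
    by apply: mulf_cont; [exact: cstf_cont|exact: uval_snd_cont].
  + move=> [t s] /= ->; rewrite clamp1; last lra.
    by rewrite clamp0; [rewrite (H01 t).2 (K01 t).1|lra].
- move=> t; rewrite uval0 uval1 ifT; last lra.
  rewrite ifF; last by apply/negbTE; rewrite -ltNge; lra.
  rewrite clamp0; last lra. rewrite clamp1; last lra.
  by split; [exact: (H01 t).1|exact: (K01 t).2].
- by move=> s; case: ifP => _; rewrite ?H0 ?K0.
- by move=> s; case: ifP => _; rewrite ?H1 ?K1.
Qed.

Lemma homotopic_comp (Y : topologicalType) (k : X -> Y) f g :
  continuous k -> homotopic_rel f g -> homotopic_rel (k \o f) (k \o g).
Proof.
move=> ck [H [cH H01 H0 H1]]; exists (k \o H); split => /=.
- exact: comp_cont.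
- by move=> t; split; rewrite ?(H01 t).1 ?(H01 t).2.
- by move=> s; rewrite H0.
- by move=> s; rewrite H1.
Qed.

Lemma homotopic_reparam f (u v : I -> I) :
  continuous f -> continuous u -> continuous v ->
  u zero = v zero -> u one = v one -> homotopic_rel (f \o u) (f \o v).
Proof.
move=> cf cu cv uv0 uv1.
exists (fun p => f (clamp ((1 - uval p.2) * uval (u p.1)
                           + uval p.2 * uval (v p.1)))); split => /=.
- apply: comp_cont => //; apply: clamp_comp_continuous; apply: addf_cont.
    apply: mulf_cont.
      apply: addf_cont; first exact: cstf_cont.
      by apply: oppf_cont; exact: uval_snd_cont.
    by apply: uval_comp_continuous; apply: comp_cont => //; exact: fst_cont.
  apply: mulf_cont; first exact: uval_snd_cont.
  by apply: uval_comp_continuous; apply: comp_cont => //; exact: fst_cont.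
- move=> t; rewrite uval0 uval1; split.
    by rewrite subr0 mul1r mul0r addr0 uvalK.
  by rewrite subrr mul0r mul1r add0r uvalK.
- by move=> s; rewrite uv0 -mulrDl subrK mul1r uvalK.
- by move=> s; rewrite uv1 -mulrDl subrK mul1r uvalK.
Qed.

Definition path_cat f g : I -> X := fun t =>
  if uval t <= 2^-1 then f (clamp (2 * uval t)) else g (clamp (2 * uval t - 1)).

Definition path_rev f : I -> X := fun t => f (clamp (1 - uval t)).

Lemma path_cat_continuous f g : continuous f -> continuous g ->
  f one = g zero -> continuous (path_cat f g).
Proof.
move=> cf cg fg; apply: paste_continuous.
- exact: uval_continuous.
- apply: comp_cont => //; apply: clamp_comp_continuous; apply: mulf_cont.
    exact: cstf_cont.
  exact: uval_continuous.
- apply: comp_cont => //; apply: clamp_comp_continuous; apply: addf_cont.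
    by apply: mulf_cont; [exact: cstf_cont|exact: uval_continuous].
  exact: cstf_cont.
- by move=> t ->; rewrite clamp1; [rewrite clamp0 //; lra|lra].
Qed.

Lemma path_cat0 f g : path_cat f g zero = f zero.
Proof.
rewrite /path_cat uval0 ifT; last lra.
by rewrite clamp0 //; lra.
Qed.

Lemma path_cat1 f g : path_cat f g one = g one.
Proof.
rewrite /path_cat uval1 ifF; last by apply/negbTE; rewrite -ltNge; lra.
by rewrite clamp1 //; lra.
Qed.

Lemma path_rev_continuous f : continuous f -> continuous (path_rev f).
Proof.
move=> cf; apply: comp_cont => //; apply: clamp_comp_continuous.
apply: addf_cont; first exact: cstf_cont.
by apply: oppf_cont; exact: uval_continuous.
Qed.

Lemma path_rev0 f : path_rev f zero = f one.
Proof. by rewrite /path_rev uval0 clamp1 //; lra. Qed.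

Lemma path_rev1 f : path_rev f one = f zero.
Proof. by rewrite /path_rev uval1 clamp0 //; lra. Qed.

Lemma homotopic_cat f f' g g' : f one = g zero ->
  homotopic_rel f f' -> homotopic_rel g g' ->
  homotopic_rel (path_cat f g) (path_cat f' g').
Proof.
move=> fg [H [cH H01 H0 H1]] [K [cK K01 K0 K1]].
exists (fun p => if uval p.1 <= 2^-1 then H (clamp (2 * uval p.1), p.2)
                 else K (clamp (2 * uval p.1 - 1), p.2)); split => /=.
- apply: paste_continuous.
  + exact: uval_fst_cont.
  + apply: comp_cont => //; apply: pair_cont; last exact: snd_cont.
    apply: clamp_comp_continuous; apply: mulf_cont; first exact: cstf_cont.
    exact: uval_fst_cont.
  + apply: comp_cont => //; apply: pair_cont; last exact: snd_cont.
    apply: clamp_comp_continuous; apply: addf_cont; last exact: cstf_cont.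
    by apply: mulf_cont; [exact: cstf_cont|exact: uval_fst_cont].
  + move=> [t s] /= ->; rewrite clamp1; last lra.
    by rewrite clamp0; [rewrite H1 K0|lra].
- move=> t; rewrite /path_cat; case: ifP => _.
    by rewrite (H01 _).1 (H01 _).2.
  by rewrite (K01 _).1 (K01 _).2.
- move=> s; rewrite path_cat0 uval0 ifT; last lra.
  by rewrite clamp0 ?H0 //; lra.
- move=> s; rewrite path_cat1 uval1 ifF; last by apply/negbTE; rewrite -ltNge; lra.
  by rewrite clamp1 ?K1 //; lra.
Qed.

Lemma homotopic_rev f f' :
  homotopic_rel f f' -> homotopic_rel (path_rev f) (path_rev f').
Proof.
case=> [H [cH H01 H0 H1]].
exists (fun p => H (clamp (1 - uval p.1), p.2)); split => /=.
- apply: comp_cont => //; apply: pair_cont; last exact: snd_cont.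
  apply: clamp_comp_continuous; apply: addf_cont; first exact: cstf_cont.
  by apply: oppf_cont; exact: uval_fst_cont.
- by move=> t; rewrite (H01 _).1 (H01 _).2.
- by move=> s; rewrite uval0 clamp1 ?H1 ?path_rev0 //; lra.
- by move=> s; rewrite uval1 clamp0 ?H0 ?path_rev1 //; lra.
Qed.

Lemma id_cont (T : topologicalType) : continuous (fun t : T => t).
Proof. by move=> t; exact: cvg_id. Qed.

Lemma homotopic_cat1f f g : continuous f -> (forall t, g t = f zero) ->
  homotopic_rel (path_cat g f) f.
Proof.
move=> cf gE; pose u (t : I) : I := clamp (2 * uval t - 1).
have -> : path_cat g f = f \o u.
  apply/funext => t; rewrite /path_cat /u /=; case: ifP => // t2.
  by rewrite gE clamp0 //; lra.
rewrite -[X in homotopic_rel _ X]/(f \o id); apply: homotopic_reparam => //.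
- apply: clamp_comp_continuous; apply: addf_cont; last exact: cstf_cont.
  by apply: mulf_cont; [exact: cstf_cont|exact: uval_continuous].
- exact: id_cont.
- by rewrite /u uval0 clamp0 //; lra.
- by rewrite /u uval1 clamp1 //; lra.
Qed.

Lemma homotopic_catf1 f g : continuous f -> (forall t, g t = f one) ->
  homotopic_rel (path_cat f g) f.
Proof.
move=> cf gE; pose u (t : I) : I := clamp (2 * uval t).
have -> : path_cat f g = f \o u.
  apply/funext => t; rewrite /path_cat /u /=; case: leP => // t2.
  by rewrite gE clamp1 //; lra.
rewrite -[X in homotopic_rel _ X]/(f \o id); apply: homotopic_reparam => //.
- apply: clamp_comp_continuous; apply: mulf_cont; first exact: cstf_cont.
  exact: uval_continuous.
- exact: id_cont.
- by rewrite /u uval0 clamp0 //; lra.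
- by rewrite /u uval1 clamp1 //; lra.
Qed.

Lemma homotopic_catV f g : continuous f -> (forall t, g t = f zero) ->
  homotopic_rel (path_cat f (path_rev f)) g.
Proof.
move=> cf gE.
pose u (t : I) : I := clamp (Num.min (2 * uval t) (2 - 2 * uval t)).
have -> : path_cat f (path_rev f) = f \o u.
  apply/funext => t; rewrite /path_cat /path_rev /u /=.
  have t01 := uval_itv t; case: leP => t2.
    by rewrite min_l //; lra.
  rewrite min_r; last lra.
  by rewrite clamp_id; [congr (f (clamp _)); lra|lra].
have -> : g = f \o (fun=> zero) by apply/funext => t; rewrite gE.
apply: homotopic_reparam => //.
- apply: clamp_comp_continuous => t.
  apply: (@continuous_min R I (fun t => 2 * uval t) (fun t => 2 - 2 * uval t)).
    by apply: mulf_cont; [exact: cstf_cont|exact: uval_continuous].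
  apply: addf_cont; first exact: cstf_cont.
  apply: oppf_cont.
  by apply: mulf_cont; [exact: cstf_cont|exact: uval_continuous].
- exact: cstf_cont.
- by rewrite /u uval0 clamp0 //; rewrite ge_min; apply/orP; left; lra.
- by rewrite /u uval1 clamp0 //; rewrite ge_min; apply/orP; right; lra.
Qed.

Lemma path_revK f : path_rev (path_rev f) = f.
Proof.
apply/funext => t; rewrite /path_rev clamp_id; last by have := uval_itv t; lra.
by rewrite subKr uvalK.
Qed.

Lemma homotopic_Vcat f g : continuous f -> (forall t, g t = f one) ->
  homotopic_rel (path_cat (path_rev f) f) g.
Proof.
move=> cf gE; rewrite -[X in path_cat _ X]path_revK; apply: homotopic_catV.
  exact: path_rev_continuous.
by move=> t; rewrite path_rev0.
Qed.

Lemma homotopic_catA f g h : continuous f -> continuous g -> continuous h ->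
  f one = g zero -> g one = h zero ->
  homotopic_rel (path_cat f (path_cat g h)) (path_cat (path_cat f g) h).
Proof.
move=> cf cg ch fg gh; apply: homotopic_sym.
pose k := path_cat f (path_cat g h).
have ck : continuous k.
  apply: path_cat_continuous => //; last by rewrite path_cat0.
  exact: path_cat_continuous.
pose u (t : I) : I :=
  clamp (if uval t <= 2^-1 then
           (if uval t <= 4^-1 then 2 * uval t else uval t + 4^-1)
         else 2^-1 * uval t + 2^-1).
have -> : path_cat (path_cat f g) h = k \o u.
  apply/funext => t; rewrite /k /path_cat /u /=.
  have t01 := uval_itv t; case: (leP (uval t) 2^-1) => t2.
    rewrite clamp_id; last lra.
    case: (leP (uval t) 4^-1) => t4.
      rewrite ifT; last lra.
      rewrite clamp_id; last lra.
      by rewrite ifT; last lra.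
    rewrite ifF; last by apply/negbTE; rewrite -ltNge; lra.
    rewrite clamp_id; last lra.
    rewrite ifF; last by apply/negbTE; rewrite -ltNge; lra.
    rewrite clamp_id; last lra.
    rewrite ifT; last lra.
    by congr (g (clamp _)); lra.
  rewrite clamp_id; last lra.
  rewrite ifF; last by apply/negbTE; rewrite -ltNge; lra.
  rewrite clamp_id; last lra.
  rewrite ifF; last by apply/negbTE; rewrite -ltNge; lra.
  by congr (h (clamp _)); lra.
rewrite -/k -[X in homotopic_rel _ X]/(k \o id); apply: homotopic_reparam => //.
- apply: clamp_comp_continuous; apply: paste_continuous.
  + exact: uval_continuous.
  + apply: paste_continuous.
    * exact: uval_continuous.
    * by apply: mulf_cont; [exact: cstf_cont|exact: uval_continuous].
    * by apply: addf_cont; [exact: uval_continuous|exact: cstf_cont].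
    * by move=> t ->; lra.
  + apply: addf_cont; last exact: cstf_cont.
    by apply: mulf_cont; [exact: cstf_cont|exact: uval_continuous].
  + by move=> t ->; rewrite ifF; [lra|apply/negbTE; rewrite -ltNge; lra].
- exact: id_cont.
- by rewrite /u uval0 ifT ?ifT ?clamp0 //; lra.
- rewrite /u uval1 ifF; last by apply/negbTE; rewrite -ltNge; lra.
  by rewrite clamp1 //; lra.
Qed.
End Homotopy.

(* Composition is written in diagrammatic order. *)
Record groupoid := Groupoid {
  gob :> Type;
  ghom : gob -> gob -> Type;
  gid : forall x, ghom x x;
  gcomp : forall x y z, ghom x y -> ghom y z -> ghom x z;
  ginv : forall x y, ghom x y -> ghom y x;
  gcompA : forall x y z t (a : ghom x y) (b : ghom y z) (c : ghom z t),
    gcomp a (gcomp b c) = gcomp (gcomp a b) c;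
  gcomp1l : forall x y (a : ghom x y), gcomp (gid x) a = a;
  gcomp1r : forall x y (a : ghom x y), gcomp a (gid y) = a;
  gcompVl : forall x y (a : ghom x y), gcomp (ginv a) a = gid y;
  gcompVr : forall x y (a : ghom x y), gcomp a (ginv a) = gid x }.

Arguments ghom {g} x y.
Arguments gid {g} x.
Arguments gcomp {g x y z} a b.
Arguments ginv {g x y} a.

(* Arrows with different end points live in different types; they are compared
   in the total type of arrows, where equality includes that of end points. *)
Definition garrow (A : groupoid) : Type := {x : A & {y : A & ghom x y}}.

Definition arrow (A : groupoid) (x y : A) (a : ghom x y) : garrow A :=
  existT _ x (existT _ y a).

Record gmor (A B : groupoid) := Gmor {
  gmor_ob :> A -> B;
  gmor_hom : forall x y : A, ghom x y -> ghom (gmor_ob x) (gmor_ob y);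
  gmor_id : forall x, gmor_hom (gid x) = gid (gmor_ob x);
  gmor_comp : forall x y z (a : ghom x y) (b : ghom y z),
    gmor_hom (gcomp a b) = gcomp (gmor_hom a) (gmor_hom b) }.

Arguments gmor_hom {A B} g {x y} _.

Definition gmor_idm (A : groupoid) : gmor A A :=
  @Gmor A A id (fun _ _ a => a) (fun=> erefl) (fun _ _ _ _ _ => erefl).

Section GmorComp.
Variables (A B C : groupoid) (psi : gmor B C) (phi : gmor A B).

Lemma gmor_compm_id (x : A) :
  gmor_hom psi (gmor_hom phi (gid x)) = gid (psi (phi x)).
Proof. by rewrite !gmor_id. Qed.

Lemma gmor_compm_comp (x y z : A) (a : ghom x y) (b : ghom y z) :
  gmor_hom psi (gmor_hom phi (gcomp a b)) =
  gcomp (gmor_hom psi (gmor_hom phi a)) (gmor_hom psi (gmor_hom phi b)).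
Proof. by rewrite !gmor_comp. Qed.

Definition gmor_compm : gmor A C :=
  @Gmor A C (fun x => psi (phi x)) (fun _ _ a => gmor_hom psi (gmor_hom phi a))
    gmor_compm_id gmor_compm_comp.
End GmorComp.

Lemma existT_inj (A : Type) (P : A -> Type) (x : A) : injective (existT P x).
Proof.
move=> p q e; have := projT2_eq e.
by rewrite (Prop_irrelevance (projT1_eq e) erefl).
Qed.

Lemma arrow_inj (A : groupoid) (x y : A) : injective (@arrow A x y).
Proof. by move=> a b ab; apply: existT_inj (existT_inj ab). Qed.

Lemma gmor_eq (A B : groupoid) (phi psi : gmor A B) :
  (forall (x y : A) (a : ghom x y),
    arrow (gmor_hom phi a) = arrow (gmor_hom psi a)) -> phi = psi.
Proof.
case: phi psi => [f fh fi fc] [g gh gi gc] /= E.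
have fg : f = g.
  by apply/funext => x; have /(congr1 (@projT1 _ _)) := E _ _ (gid x).
case: _ / fg in gh gi gc E *.
have hE : fh = gh.
  apply: functional_extensionality_dep => x.
  apply: functional_extensionality_dep => y.
  by apply/funext => a; apply: arrow_inj; exact: E.
case: _ / hE in gi gc E *.
by rewrite (Prop_irrelevance fi gi) (Prop_irrelevance fc gc).
Qed.

Record gaction (G : groupType) (A : groupoid) := GAction {
  gact : G -> gmor A A;
  gact1 : gact 1%g = gmor_idm A;
  gactM : forall h g, gact (h * g)%g = gmor_compm (gact h) (gact g) }.

Definition ginvariant (G : groupType) (A B : groupoid) (act : gaction G A)
    (phi : gmor A B) : Prop :=
  forall g : G,
    (forall x : A, phi (gact act g x) = phi x) /\
    (forall (x y : A) (a : ghom x y),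
      arrow (gmor_hom phi (gmor_hom (gact act g) a)) = arrow (gmor_hom phi a)).

(* [B] with [p] is an orbit groupoid [A // G]. *)
Definition orbit_morphism (G : groupType) (A B : groupoid) (act : gaction G A)
    (p : gmor A B) : Prop :=
  ginvariant act p /\
  forall (C : groupoid) (phi : gmor A C), ginvariant act phi ->
    exists! phi' : gmor B C, gmor_compm phi' p = phi.

Section FundamentalGroupoid.
Variables (R : realType) (X : topologicalType).
Local Notation I := (unit_interval R).
Local Notation path x y := {path I from x to y in X}.

Definition path_homotopy (x y : X) : rel (path x y) :=
  fun a b => `[< @homotopic_rel R X a b >].

Lemma path_continuous (x y : X) (a : path x y) : continuous a.
Proof. exact: cts_fun. Qed.

Arguments path_continuous [x y] a.

Lemma path_homotopy_refl (x y : X) : reflexive (@path_homotopy x y).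
Proof. by move=> a; apply/asboolP/homotopic_refl/path_continuous. Qed.

Lemma path_homotopy_sym (x y : X) : symmetric (@path_homotopy x y).
Proof. by move=> a b; apply/asboolP/asboolP; exact: homotopic_sym. Qed.

Lemma path_homotopy_trans (x y : X) : transitive (@path_homotopy x y).
Proof.
by move=> b a c /asboolP ab /asboolP bc; apply/asboolP/(homotopic_trans ab bc).
Qed.

Definition path_homotopy_equiv (x y : X) :=
  EquivRel _ (@path_homotopy_refl x y) (@path_homotopy_sym x y)
    (@path_homotopy_trans x y).

Definition path_class (x y : X) := {eq_quot (path_homotopy_equiv x y)}.

Definition pclass (x y : X) (a : path x y) : path_class x y :=
  \pi_(path_class x y) a.

Lemma pclassP (x y : X) (a b : path x y) :
  pclass a = pclass b <-> homotopic_rel a b.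
Proof.
split=> [/eqmodP/asboolP //|ab].
by apply/eqmodP/asboolP.
Qed.

Lemma pclass_repr (x y : X) (a : path_class x y) : pclass (repr a) = a.
Proof. exact: reprK. Qed.

Lemma repr_pclass (x y : X) (a : path x y) : homotopic_rel (repr (pclass a)) a.
Proof. by apply/pclassP; rewrite pclass_repr. Qed.

Lemma path_src (x y : X) (a : path x y) : a zero = x.
Proof. exact: path_zero. Qed.

Lemma path_tgt (x y : X) (a : path x y) : a one = y.
Proof. exact: path_one. Qed.

Lemma path_join (x y z : X) (a : path x y) (b : path y z) : a one = b zero.
Proof. by rewrite path_one path_zero. Qed.

Definition pconst (x : X) : path x x := cst x.

Definition pcat (x y z : X) (a : path x y) (b : path y z) : path x z :=
  mk_path
    (path_cat_continuous (path_continuous a) (path_continuous b) (path_join a b))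
    (etrans (path_cat0 a b) (path_src a)) (etrans (path_cat1 a b) (path_tgt b)).

Definition prev (x y : X) (a : path x y) : path y x :=
  mk_path (path_rev_continuous (path_continuous a))
    (etrans (path_rev0 a) (path_tgt a)) (etrans (path_rev1 a) (path_src a)).

Definition pi_comp (x y z : X) (a : path_class x y) (b : path_class y z) :
  path_class x z := pclass (pcat (repr a) (repr b)).

Definition pi_inv (x y : X) (a : path_class x y) : path_class y x :=
  pclass (prev (repr a)).

Lemma pi_compE (x y z : X) (a : path x y) (b : path y z) :
  pi_comp (pclass a) (pclass b) = pclass (pcat a b).
Proof.
by apply/pclassP/homotopic_cat; [exact: path_join|exact: repr_pclass..].
Qed.

Lemma pi_invE (x y : X) (a : path x y) : pi_inv (pclass a) = pclass (prev a).
Proof. by apply/pclassP/homotopic_rev; exact: repr_pclass. Qed.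

Lemma pi_compA (x y z t : X) (a : path_class x y) (b : path_class y z)
    (c : path_class z t) :
  pi_comp a (pi_comp b c) = pi_comp (pi_comp a b) c.
Proof.
rewrite -[a]pclass_repr -[b]pclass_repr -[c]pclass_repr !pi_compE.
by apply/pclassP/homotopic_catA;
  [exact: path_continuous..|exact: path_join|exact: path_join].
Qed.

Lemma pi_comp1l (x y : X) (a : path_class x y) : pi_comp (pclass (pconst x)) a = a.
Proof.
rewrite -[a]pclass_repr pi_compE; apply/pclassP/homotopic_cat1f.
  exact: path_continuous.
by move=> t; rewrite path_zero.
Qed.

Lemma pi_comp1r (x y : X) (a : path_class x y) : pi_comp a (pclass (pconst y)) = a.
Proof.
rewrite -[a]pclass_repr pi_compE; apply/pclassP/homotopic_catf1.
  exact: path_continuous.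
by move=> t; rewrite path_one.
Qed.

Lemma pi_compVr (x y : X) (a : path_class x y) :
  pi_comp a (pi_inv a) = pclass (pconst x).
Proof.
rewrite -[a]pclass_repr pi_invE pi_compE; apply/pclassP/homotopic_catV.
  exact: path_continuous.
by move=> t; rewrite path_zero.
Qed.

Lemma pi_compVl (x y : X) (a : path_class x y) :
  pi_comp (pi_inv a) a = pclass (pconst y).
Proof.
rewrite -[a]pclass_repr pi_invE pi_compE; apply/pclassP/homotopic_Vcat.
  exact: path_continuous.
by move=> t; rewrite path_one.
Qed.

Definition fundamental_groupoid : groupoid :=
  @Groupoid X path_class (fun x => pclass (pconst x)) pi_comp pi_inv
    pi_compA pi_comp1l pi_comp1r pi_compVl pi_compVr.
End FundamentalGroupoid.

Section InducedMorphism.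
Variables (R : realType) (X Y : topologicalType) (f : continuousType X Y).
Local Notation I := (unit_interval R).
Local Notation piX := (fundamental_groupoid R X).
Local Notation piY := (fundamental_groupoid R Y).

Definition pmap (x y : X) (a : {path I from x to y in X}) :
  {path I from f x to f y in Y} := f \o a.

Definition pi_map (x y : X) (a : path_class R x y) : path_class R (f x) (f y) :=
  pclass (pmap (repr a)).

Lemma pi_mapE (x y : X) (a : {path I from x to y in X}) :
  pi_map (pclass a) = pclass (pmap a).
Proof.
apply/pclassP; apply: homotopic_comp; [exact: cts_fun|exact: repr_pclass].
Qed.

Lemma pi_map_id (x : X) : pi_map (@gid piX x) = @gid piY (f x).
Proof. by rewrite /= pi_mapE; congr pclass; apply/path_eqP. Qed.

Lemma pi_map_comp (x y z : X) (a : path_class R x y) (b : path_class R y z) :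
  pi_map (pi_comp a b) = pi_comp (pi_map a) (pi_map b).
Proof.
rewrite -[a]pclass_repr -[b]pclass_repr pi_compE !pi_mapE pi_compE.
congr pclass; apply/path_eqP => t /=; rewrite /pcat /pmap /mk_path /= /path_cat.
by case: ifP.
Qed.

Definition pi_mor : gmor piX piY := @Gmor piX piY f pi_map pi_map_id pi_map_comp.
End InducedMorphism.

Arguments pi_mor R {X Y} f.

Lemma arrow_pclass (R : realType) (X : topologicalType) (x y x' y' : X)
    (a : {path (unit_interval R) from x to y in X})
    (b : {path (unit_interval R) from x' to y' in X}) :
  a =1 b ->
  @arrow (fundamental_groupoid R X) x y (pclass a) =
  @arrow (fundamental_groupoid R X) x' y' (pclass b).
Proof.
move=> ab.
have xx' : x = x' by rewrite -(path_src a) -(path_src b) ab.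
have yy' : y = y' by rewrite -(path_tgt a) -(path_tgt b) ab.
case: _ / xx' in b ab *; case: _ / yy' in b ab *.
by move/path_eqP : ab => ->.
Qed.

Record top_action (G : groupType) (X : topologicalType) := TopAction {
  tact :> G -> X -> X;
  tact1 : forall x, tact 1%g x = x;
  tactM : forall g h x, tact g (tact h x) = tact (g * h)%g x;
  tact_continuous : forall g, continuous (tact g) }.

Section TopAction.
Variables (G : groupType) (X : topologicalType) (act : top_action G X).

Definition stabiliser (x : X) : set G := [set g | act g x = x].

Definition tact_map (g : G) : continuousType X X :=
  mkcts (tact_continuous (t := act) (g := g)).

Definition same_orbit : rel X := fun x y => `[< exists g, act g x = y >].

Lemma same_orbit_refl : reflexive same_orbit.
Proof. by move=> x; apply/asboolP; exists 1%g; rewrite tact1. Qed.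

Lemma same_orbit_sym : symmetric same_orbit.
Proof.
have sym x y : same_orbit x y -> same_orbit y x.
  move=> /asboolP[g <-]; apply/asboolP; exists g^-1%g.
  by rewrite tactM mulVg tact1.
by move=> x y; apply/idP/idP; exact: sym.
Qed.

Lemma same_orbit_trans : transitive same_orbit.
Proof.
move=> y x z /asboolP[g <-] /asboolP[h <-]; apply/asboolP; exists (h * g)%g.
by rewrite tactM.
Qed.

Definition same_orbit_equiv :=
  EquivRel _ same_orbit_refl same_orbit_sym same_orbit_trans.

Definition orbit_space := {eq_quot same_orbit_equiv}.

HB.instance Definition _ :=
  Topological.copy orbit_space (quotient_topology orbit_space).
HB.instance Definition _ := Quotient.on orbit_space.

Lemma orbit_proj_continuous : continuous (\pi_orbit_space : X -> orbit_space).
Proof. exact: pi_continuous. Qed.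

Definition orbit_proj : continuousType X orbit_space :=
  mkcts orbit_proj_continuous.

Section PiAction.
Variable R : realType.
Local Notation piX := (fundamental_groupoid R X).

Lemma pi_tact1 : pi_mor R (tact_map 1%g) = gmor_idm piX.
Proof.
apply: gmor_eq => x y a /=; rewrite -[a in RHS]pclass_repr.
by apply: arrow_pclass => t /=; rewrite /mkcts tact1.
Qed.

Lemma pi_tactM (h g : G) :
  pi_mor R (tact_map (h * g)%g) =
  gmor_compm (pi_mor R (tact_map h)) (pi_mor R (tact_map g)).
Proof.
apply: gmor_eq => x y a /=; rewrite -[a]pclass_repr !pi_mapE.
by apply: arrow_pclass => t /=; rewrite /mkcts tactM.
Qed.

Definition pi_action : gaction G piX :=
  @GAction G piX (fun g => pi_mor R (tact_map g)) pi_tact1 pi_tactM.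
End PiAction.
End TopAction.

Arguments stabiliser {G X} act x.
Arguments orbit_space {G X} act.
Arguments orbit_proj {G X} act.
Arguments pi_action {G X} act R.

Definition path_lifting (R : realType) (X Y : topologicalType) (p : X -> Y) :=
  forall abar : continuousType (unit_interval R) Y,
    exists a : continuousType (unit_interval R) X, p \o a = abar.

Arguments path_lifting R {X Y} p.

(* Main.v *)
Require Import Defs.
From mathcomp Require Import all_boot all_order all_algebra.
From mathcomp Require Import all_classical all_reals all_analysis.
From mathcomp Require Import homotopy.
From mathcomp Require Import lra.

(* Let [phi] be an invariant morphism on [pi X]. Two lifts of the same path have
   the same image under [phi]: by (ii)(b) they agree near each parameter, once one
   of them is translated to pass through the same point, and the unit interval is
   connected. Hence [phi] gives a value to every path of [X/G], functorially for
   concatenation, and the point is its invariance under a homotopy [H] on the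
   square. For this it is enough that every point [z] of the square has a
   neighbourhood in which all loops have a trivial value under [H]. Otherwise
   choose loops at [z] with nontrivial values that shrink to [z], concatenate them
   all into a single path starting at [z], and lift its image to a path [a] of [X].
   Near 0 this [a] lies in the neighbourhood of [a 0] given by (ii); the parts of
   [a] up to the beginning and up to the end of one of the loops have homotopic
   projections, because the square is convex, so (ii)(b) forces the value of that
   loop to be trivial. *)

Set Implicit Arguments.
Unset Strict Implicit.
Unset Printing Implicit Defensive.

Import Order.TTheory GRing.Theory Num.Theory.
Import numFieldNormedType.Exports.

Local Open Scope classical_set_scope.
Local Open Scope ring_scope.
Local Open Scope quotient_scope.

(** * Connectedness and convexity of the unit interval *)

Section UnitIntervalTopology.
Variable R : realType.
Local Notation I := (unit_interval R).

Lemma near_uval (s : I) (e : R) : 0 < e ->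
  nbhs s [set t : I | `|uval t - uval s| < e].
Proof.
move=> e0; have : nbhs s (uval @^-1` ball (uval s) e).
  by apply: uval_continuous; exact: nbhsx_ballx.
by apply: filterS => t; rewrite /ball /= distrC.
Qed.

(** [clamp] is a continuous left inverse of [uval], so a neighbourhood in the interval pulls back to
    one in [R]. *)
Lemma nbhs_uval (s : I) (U : set I) : nbhs s U ->
  exists2 e : R, 0 < e & forall t : I, `|uval t - uval s| < e -> U t.
Proof.
move=> sU; have : nbhs (uval s) (clamp @^-1` U).
  by apply: (@clamp_continuous R); rewrite uvalK.
move=> /nbhs_ballP[e /= e0 eU]; exists e => // t ts.
by rewrite -(uvalK t); apply: eU; rewrite /ball /= distrC.
Qed.

Lemma unit_interval_connected : connected [set: I].
Proof.
have -> : [set: I] = clamp @` `[0, 1]%classic.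
  apply/seteqP; split=> // t _; exists (uval t); last exact: uvalK.
  by rewrite /= in_itv /= uval_itv.
apply: connected_continuous_connected; first exact: segment_connected.
by apply: continuous_subspaceT; exact: clamp_continuous.
Qed.

(** The set of points reached from [s] is open by the first half of the local condition, and its
    complement is open by the second half; connectedness concludes. This replaces the usual
    subdivision by a Lebesgue number. *)
Lemma unit_interval_chain (E : I -> I -> Prop) :
  (forall r s t, E r s -> E s t -> E r t) ->
  (forall s, nbhs s [set t | E s t /\ E t s]) -> forall s t, E s t.
Proof.
move=> Etr Eloc s t; have ss : E s s by have [] := nbhs_singleton (Eloc s).
suff : [set u | E s u] = [set: I] by move/seteqP => [_]; exact.
apply: unit_interval_connected.
- by exists s.
- exists [set u | E s u]; last by rewrite setTI.
  rewrite openE => u su; apply: filterS (Eloc u) => v [uv _] /=; exact: Etr uv.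
- exists [set u | E s u]; last by rewrite setTI.
  rewrite -openC openE => u su; apply: filterS (Eloc u) => v [_ vu] /= sv.
  by apply: su => /=; exact: Etr vu.
Qed.

Definition seg_fun (s t r : I) : I :=
  clamp ((1 - uval r) * uval s + uval r * uval t).

Lemma seg_fun_continuous (s t : I) : continuous (seg_fun s t).
Proof.
apply: clamp_comp_continuous; apply: addf_cont; apply: mulf_cont;
  try exact: cstf_cont; try exact: uval_continuous.
by apply: addf_cont; [exact: cstf_cont|apply: oppf_cont; exact: uval_continuous].
Qed.

Lemma seg_fun0 (s t : I) : seg_fun s t zero = s.
Proof. by rewrite /seg_fun uval0 subr0 mul1r mul0r addr0 uvalK. Qed.

Lemma seg_fun1 (s t : I) : seg_fun s t one = t.
Proof. by rewrite /seg_fun uval1 subrr mul0r mul1r add0r uvalK. Qed.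

Definition seg (s t : I) : {path I from s to t in I} :=
  mk_path (@seg_fun_continuous s t) (seg_fun0 s t) (seg_fun1 s t).

Lemma convex_comb_itv (a b r s t : R) : 0 <= r <= 1 ->
  a <= s <= b -> a <= t <= b -> a <= (1 - r) * s + r * t <= b.
Proof.
move=> /andP[r0 r1] /andP[as_ sb] /andP[at_ tb].
have r1' : 0 <= 1 - r by lra.
have [h1 h2] : 0 <= (1 - r) * (s - a) /\ 0 <= r * (t - a).
  by split; apply: mulr_ge0; lra.
have [h3 h4] : 0 <= (1 - r) * (b - s) /\ 0 <= r * (b - t).
  by split; apply: mulr_ge0; lra.
lra.
Qed.

Lemma uval_seg (s t r : I) :
  uval (seg s t r) = (1 - uval r) * uval s + uval r * uval t.
Proof.
rewrite /seg /mk_path /= clamp_id //.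
by apply: convex_comb_itv; exact: uval_itv.
Qed.

(** Balls are convex: a convex combination lies between the minimum and the maximum of the two end
    points. *)
Lemma seg_near (s t t' r : I) (e : R) :
  `|uval t - uval s| < e -> `|uval t' - uval s| < e ->
  `|uval (seg t t' r) - uval s| < e.
Proof.
rewrite uval_seg !ltr_norml => /andP[? ?] /andP[? ?].
have := @convex_comb_itv (Num.min (uval t) (uval t')) (Num.max (uval t) (uval t'))
  _ _ _ (uval_itv r).
move=> /(_ (uval t) (uval t')); rewrite !(ge_min, le_max) !lexx ?orbT /=.
move=> /(_ isT isT); case: (leP (uval t) (uval t')) => _ /andP[? ?];
  by apply/andP; split; lra.
Qed.

(** Both maps are reparametrisations of the identity, so the straight-line homotopy joins them. *)
Lemma homotopic_unit_interval (f g : I -> I) :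
  continuous f -> continuous g -> f zero = g zero -> f one = g one ->
  homotopic_rel f g.
Proof. by move=> cf cg f0 f1; exact: (@homotopic_reparam _ _ id f g (@id_cont _)). Qed.

Lemma homotopic_pair (X Y : topologicalType) (f f' : I -> X) (g g' : I -> Y) :
  homotopic_rel f f' -> homotopic_rel g g' ->
  homotopic_rel (fun t => (f t, g t)) (fun t => (f' t, g' t)).
Proof.
move=> [H [cH H01 H0 H1]] [K [cK K01 K0 K1]].
exists (fun p => (H p, K p)); split => [|t|s|s]; last 2 first.
- by rewrite H0 K0.
- by rewrite H1 K1.
- exact: pair_cont.
- by rewrite (H01 t).1 (H01 t).2 (K01 t).1 (K01 t).2.
Qed.

Lemma homotopic_square (f g : I -> I * I) :
  continuous f -> continuous g -> f zero = g zero -> f one = g one ->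
  homotopic_rel f g.
Proof.
move=> cf cg f0 f1.
have E (h : I -> I * I) : h = (fun t => ((h t).1, (h t).2)).
  by apply/funext => t; case: (h t).
rewrite (E f) (E g); apply: homotopic_pair; apply: homotopic_unit_interval;
  by [apply: comp_cont => //; exact: fst_cont|
      apply: comp_cont => //; exact: snd_cont|rewrite ?f0 ?f1].
Qed.

End UnitIntervalTopology.

(** * Negative powers of two *)

Section Dyadic.
Variable R : realType.

Lemma dyadic_anti m n : (m <= n)%N -> (2 : R) ^- n <= 2 ^- m.
Proof. by move=> mn; rewrite lef_pV2 ?posrE ?exprn_gt0// ler_weXn2l// ler1n. Qed.

Lemma dyadic_bound n : 0 <= (2 : R) ^- n <= 1.
Proof.
by rewrite invr_ge0 exprn_ge0 //= -[leRHS]invr1 -(expr0 2); exact: dyadic_anti.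
Qed.

Lemma exists_dyadic_le (u : R) : 0 < u -> exists n, 2 ^- n <= u.
Proof.
move=> u0; have h2 : `|2^-1 : R| < 1 by rewrite ger0_norm; lra.
move: (cvg_geometric 1 h2).
move=> /cvgrPdist_le/(_ u u0)[n _ /(_ n (leqnn n))] /=.
rewrite sub0r normrN mul1r exprVn ger0_norm; first by exists n.
by rewrite invr_ge0 exprn_ge0.
Qed.
End Dyadic.

(** * Concatenation of infinitely many loops *)

Section InfiniteConcatenation.
Variables (R : realType) (T : topologicalType) (z : T).
Local Notation I := (unit_interval R).
Variable l : nat -> {path I from z to z in T}.

Local Notation r n := ((2 : R) ^- n).

Let r_gt0 n : 0 < r n.
Proof. by rewrite invr_gt0 exprn_gt0. Qed.

Let rS n : r n = 2 * r n.+1.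
Proof. by rewrite exprS invfM mulrA divff ?mul1r. Qed.

Let r_anti m n : (m <= n)%N -> r n <= r m.
Proof. exact: dyadic_anti. Qed.

(* The loop [l n] is run through on [2 ^- n.+1, 2 ^- n]. *)
Definition piece n (u : R) : T := l n (clamp (2 ^+ n.+1 * u - 1)).

Lemma piece_le n u : u <= r n.+1 -> piece n u = z.
Proof.
move=> ur; rewrite /piece clamp0 ?path_zero// subr_le0 mulrC.
by rewrite -ler_pdivlMr ?exprn_gt0 // mul1r.
Qed.

Lemma piece_ge n u : r n <= u -> piece n u = z.
Proof.
move=> ur; rewrite /piece clamp1 ?path_one// lerBrDr mulrC.
by rewrite -ler_pdivrMr ?exprn_gt0 // (le_trans _ ur)// (rS n) mulrC.
Qed.

Lemma piece_continuous n : continuous (piece n).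
Proof.
apply: comp_cont; first exact: cts_fun.
apply: clamp_comp_continuous; apply: addf_cont; last exact: cstf_cont.
by apply: mulf_cont; [exact: cstf_cont|exact: id_cont].
Qed.

(** The finite stage: the loops of index below [n] fill the part from [r n] to 1, the largest index
    first, and everything below [r n] is sent to [z]. *)
Fixpoint partial_cat n : R -> T :=
  if n is m.+1 then fun u => if u <= r m then piece m u else partial_cat m u
  else cst z.

Lemma partial_cat_le n u : u <= r n -> partial_cat n u = z.
Proof.
case: n => //= n ur; rewrite ifT ?piece_le// (le_trans ur)//.
exact: r_anti.
Qed.

Lemma partial_cat_continuous n : continuous (partial_cat n).
Proof.
elim: n => [|n IH] /=; first exact: cstf_cont.
apply: paste_continuous => //; [exact: id_cont|exact: piece_continuous|].
by move=> t ->; rewrite piece_ge// partial_cat_le.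
Qed.

(** Later stages only change values below [r m]. When a new piece applies at all, [u] is its right
    end [r n], where both branches equal [z]. *)
Lemma partial_cat_stable m n u : (m <= n)%N -> r m <= u ->
  partial_cat n u = partial_cat m u.
Proof.
move=> + mu; elim: n => [|n IH]; first by rewrite leqn0 => /eqP ->.
rewrite leq_eqVlt => /predU1P[-> //|/[!ltnS] mn] /=.
rewrite -(IH mn); case: leP => // un.
have nu : r n <= u by exact: le_trans (r_anti mn) mu.
by rewrite piece_ge// partial_cat_le.
Qed.

(** Below [r m] only loops of index at least [m], or the base point, are met. This gives continuity
    of the infinite concatenation at 0. *)
Lemma partial_cat_tail (U : set T) m n u : U z ->
  (forall k t, (m <= k)%N -> U (l k t)) -> u <= r m -> U (partial_cat n u).
Proof.
move=> Uz Ul um; elim: n => [//|n IH] /=; case: leP => // un.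
have [mn|nm] := leqP m n; first exact: Ul.
by rewrite piece_le // (le_trans um)// r_anti.
Qed.

(** Any stage reaching down to [uval t] may be chosen, since by [partial_cat_stable] they all agree
    there. *)
Definition infinite_cat (t : I) : T :=
  match pselect (0 < uval t) with
  | left t0 => partial_cat (projT1 (cid (exists_dyadic_le t0))) (uval t)
  | right _ => z
  end.

Lemma infinite_catE n (t : I) : r n <= uval t ->
  infinite_cat t = partial_cat n (uval t).
Proof.
move=> nt; rewrite /infinite_cat; case: pselect => [t0|]; last first.
  by move=> []; apply: lt_le_trans nt.
case: cid => m /= mt; have [mn|nm] := leqP m n.
  by rewrite (partial_cat_stable mn).
by rewrite (partial_cat_stable (ltnW nm)).
Qed.

Lemma infinite_cat_small (t : I) : uval t <= 0 -> infinite_cat t = z.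
Proof. by rewrite leNgt => /negP t0; rewrite /infinite_cat; case: pselect. Qed.

Lemma infinite_cat_continuous :
  (forall U, nbhs z U -> exists m, forall k t, (m <= k)%N -> U (l k t)) ->
  continuous infinite_cat.
Proof.
move=> lz t; have [t0|t0] := leP (uval t) 0.
  move=> U /=; rewrite infinite_cat_small// => Uz; have [m Ul] := lz U Uz.
  apply: filterS (near_uval t (r_gt0 m)) => s /= st.
  have [s0|s0] := leP (uval s) 0.
    by rewrite infinite_cat_small//; exact: nbhs_singleton.
  rewrite /infinite_cat; case: pselect => // s0'.
  apply: partial_cat_tail Ul _; first exact: nbhs_singleton.
  have t00 : uval t = 0 by have /andP[? _] := uval_itv t; lra.
  by move: st; rewrite t00 subr0 ger0_norm => [/ltW//|]; exact: ltW.
(* Half of [uval t] bounds from below all parameters within that distance of [t], so one finite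
   stage computes the concatenation near [t]. *)
have t02 : 0 < uval t / 2 by lra.
have [n nt] := exists_dyadic_le t02 => U /=.
rewrite (@infinite_catE n); last lra.
move=> Ut; have h : nbhs t [set s : I | U (partial_cat n (uval s))].
  by apply: (comp_cont (@partial_cat_continuous n) (@uval_continuous R)).
apply: filterS (filterI h (near_uval t t02)) => s /= [Us].
rewrite ltr_norml => /andP[st _]; rewrite (@infinite_catE n) //; lra.
Qed.

(** The segment is at [r n.+1 * (1 + uval t)] at time [t], and the affine change of parameter in
    [piece] sends this back to [uval t]. *)
Lemma infinite_cat_seg n (t : I) :
  infinite_cat (seg (clamp (r n.+1)) (clamp (r n)) t) = l n t.
Proof.
have /andP[t0 t1] := uval_itv t; have := rS n; have := r_gt0 n.+1 => r0 rE.
have tE : uval (seg (clamp (r n.+1)) (clamp (r n)) t) = r n.+1 * (1 + uval t).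
  by rewrite uval_seg !clamp_id ?dyadic_bound // rE; lra.
rewrite (@infinite_catE n.+1); last by rewrite tE; nra.
rewrite tE /= ifT; last by rewrite rE; nra.
rewrite /piece mulrA divff ?expf_neq0// mul1r.
by rewrite [1 + _]addrC addrK uvalK.
Qed.

End InfiniteConcatenation.

(** * Boxes and straight segments in the square *)

Section UnitSquare.
Variable R : realType.
Local Notation I := (unit_interval R).

Definition box (z : I * I) (e : R) : set (I * I) :=
  [set w | `|uval w.1 - uval z.1| < e /\ `|uval w.2 - uval z.2| < e].

Lemma nbhs_box (z : I * I) (U : set (I * I)) : nbhs z U ->
  exists2 e : R, 0 < e & box z e `<=` U.
Proof.
move=> [[V W] /= [/nbhs_uval[d d0 dV] /nbhs_uval[e e0 eW]] VWU].
exists (Num.min d e); first by rewrite lt_min d0.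
move=> [s t] [/=]; rewrite !lt_min => /andP[sd _] /andP[_ te].
by apply: VWU; split => /=; [exact: dV|exact: eW].
Qed.

Lemma seg2_fun_continuous (z w : I * I) :
  continuous (fun t : I => (seg z.1 w.1 t, seg z.2 w.2 t)).
Proof. by apply: pair_cont; exact: cts_fun. Qed.

Definition seg2 (z w : I * I) : {path I from z to w in (I * I)%type}.
Proof.
refine (mk_path (@seg2_fun_continuous z w) _ _).
- by rewrite !path_zero; case: z.
- by rewrite !path_one; case: w.
Defined.

Lemma seg2_box (z w : I * I) (e : R) t : 0 < e -> box z e w -> box z e (seg2 z w t).
Proof.
by move=> e0 [w1 w2]; split; apply: seg_near => //; rewrite subrr normr0.
Qed.

Lemma seg01 (t : I) : seg zero one t = t.
Proof. by apply: uval_inj; rewrite uval_seg uval0 uval1; lra. Qed.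

Lemma row_continuous (s : I) : continuous (fun t : I => (t, s)).
Proof. by apply: pair_cont; [exact: id_cont|exact: cstf_cont]. Qed.

Lemma col_continuous (t : I) : continuous (fun s : I => (t, s)).
Proof. by apply: pair_cont; [exact: cstf_cont|exact: id_cont]. Qed.

Definition hseg (t t' s : I) : {path I from (t, s) to (t', s) in (I * I)%type} :=
  Defs.pmap (mkcts (@row_continuous s)) (seg t t').

Definition vseg (t s s' : I) : {path I from (t, s) to (t, s') in (I * I)%type} :=
  Defs.pmap (mkcts (@col_continuous t)) (seg s s').

End UnitSquare.

(** * Calculus of arrows in the total type *)

Section GroupoidArrows.
Variable A : groupoid.

Lemma arrow_ends (x y x' y' : A) (a : ghom x y) (a' : ghom x' y') :
  arrow a = arrow a' -> x = x' /\ y = y'.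
Proof.
by move=> e; split; [exact: (congr1 (@projT1 _ _) e)
                    |exact: (congr1 (fun s => projT1 (projT2 s)) e)].
Qed.

(** Lets composites be compared factor by factor when the end points are provably equal but not
    convertible. *)
Lemma arrow_gcomp (x y z x' y' z' : A) (a : ghom x y) (b : ghom y z)
    (a' : ghom x' y') (b' : ghom y' z') :
  arrow a = arrow a' -> arrow b = arrow b' ->
  arrow (gcomp a b) = arrow (gcomp a' b').
Proof.
move=> aa' bb'; have [xx' yy'] := arrow_ends aa'.
have [_ zz'] := arrow_ends bb'.
case: _ / xx' in a' aa' *; case: _ / yy' in a' aa' b' bb' *.
by case: _ / zz' in b' bb' *; rewrite (arrow_inj aa') (arrow_inj bb').
Qed.

Lemma arrow_ginv (x y x' y' : A) (a : ghom x y) (a' : ghom x' y') :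
  arrow a = arrow a' -> arrow (ginv a) = arrow (ginv a').
Proof.
move=> aa'; have [xx' yy'] := arrow_ends aa'.
case: _ / xx' in a' aa' *; case: _ / yy' in a' aa' *.
by rewrite (arrow_inj aa').
Qed.

Lemma arrow_gid (x x' : A) : x = x' -> arrow (gid x) = arrow (gid x').
Proof. by move->. Qed.

Lemma gcompKl (x y z : A) (a : ghom x y) : injective (@gcomp A x y z a).
Proof.
by move=> b c /(congr1 (gcomp (ginv a))); rewrite !gcompA gcompVl !gcomp1l.
Qed.

Lemma gcompKr (x y z : A) (c : ghom y z) :
  injective (fun a : ghom x y => gcomp a c).
Proof.
by move=> a b /(congr1 (gcomp^~ (ginv c))); rewrite -!gcompA gcompVr !gcomp1r.
Qed.

Lemma ginv_gcomp1 (x y : A) (a : ghom x y) (b : ghom y x) :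
  gcomp a b = gid x -> b = ginv a.
Proof. by move=> ab; apply: (@gcompKl _ _ _ a); rewrite ab gcompVr. Qed.

(** Comparing end points first shows that [b] is a loop; then [a] cancels on the left. *)
Lemma arrow_gcomp_fix (x y z : A) (a : ghom x y) (b : ghom y z) :
  arrow (gcomp a b) = arrow a -> arrow b = arrow (gid y).
Proof.
move=> ab; have [_ zy] := arrow_ends ab.
move/esym: zy => zy; case: _ / zy in b ab *.
by congr arrow; apply: (@gcompKl _ _ _ a); rewrite (arrow_inj ab) gcomp1r.
Qed.

Lemma arrow_gmor (B : groupoid) (phi : gmor A B) (x y x' y' : A)
    (a : ghom x y) (a' : ghom x' y') :
  arrow a = arrow a' -> arrow (gmor_hom phi a) = arrow (gmor_hom phi a').
Proof.
move=> aa'; have [xx' yy'] := arrow_ends aa'.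
case: _ / xx' in a' aa' *; case: _ / yy' in a' aa' *.
by rewrite (arrow_inj aa').
Qed.

End GroupoidArrows.

Lemma gmor_inv (A B : groupoid) (phi : gmor A B) (x y : A) (a : ghom x y) :
  gmor_hom phi (ginv a) = ginv (gmor_hom phi a).
Proof. by apply: ginv_gcomp1; rewrite -gmor_comp gcompVr gmor_id. Qed.

(** * Arrows represented by paths *)

Section FundamentalGroupoidArrows.
Variables (R : realType) (X : topologicalType).
Local Notation I := (unit_interval R).
Local Notation piX := (fundamental_groupoid R X).

(** A retyping of [pclass] as a groupoid arrow, so that the groupoid operations apply to it
    directly. *)
Definition pi_hom (x y : X) (a : {path I from x to y in X}) :
  @ghom piX x y := pclass a.

Lemma arrow_homotopic (x y x' y' : X) (a : {path I from x to y in X})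
    (b : {path I from x' to y' in X}) :
  homotopic_rel a b -> arrow (pi_hom a) = arrow (pi_hom b).
Proof.
move=> ab; have [] := homotopic_rel_ends ab.
rewrite !path_zero !path_one => xx' yy'.
case: _ / xx' in b ab *; case: _ / yy' in b ab *.
by congr arrow; apply/pclassP.
Qed.

Lemma pi_hom_cat (x y z : X) (a : {path I from x to y in X})
    (b : {path I from y to z in X}) :
  pi_hom (pcat a b) = gcomp (pi_hom a) (pi_hom b).
Proof. exact/esym/pi_compE. Qed.

Lemma pi_hom_rev (x y : X) (a : {path I from x to y in X}) :
  pi_hom (Defs.prev a) = ginv (pi_hom a).
Proof. exact/esym/pi_invE. Qed.

Lemma pi_hom_repr (x y : X) (a : @ghom piX x y) :
  exists b : {path I from x to y in X}, a = pi_hom b.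
Proof. by exists (repr a); rewrite /pi_hom pclass_repr. Qed.

End FundamentalGroupoidArrows.

(** * The fundamental groupoid of the interval *)

Section PathsInUnitInterval.
Variable R : realType.
Local Notation I := (unit_interval R).

Lemma pi_hom_unit_interval (s t : I) (a b : {path I from s to t in I}) :
  pi_hom a = pi_hom b.
Proof.
apply/pclassP; apply: homotopic_unit_interval; rewrite ?path_zero ?path_one //;
  exact: cts_fun.
Qed.

Lemma gcomp_seg (r s t : I) :
  gcomp (pi_hom (seg r s)) (pi_hom (seg s t)) = pi_hom (seg r t).
Proof. by rewrite -pi_hom_cat; exact: pi_hom_unit_interval. Qed.

Lemma ginv_seg (s t : I) : ginv (pi_hom (seg s t)) = pi_hom (seg t s).
Proof. by rewrite -pi_hom_rev; exact: pi_hom_unit_interval. Qed.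

End PathsInUnitInterval.

(** * Values of an invariant morphism on paths of the orbit space *)

Section OrbitGroupoid.
Variables (R : realType) (G : groupType) (X : topologicalType).
Variable act : top_action G X.
Local Notation I := (unit_interval R).
Local Notation Y := (orbit_space act).
Local Notation p := (orbit_proj act).

Lemma orbit_projP (x y : X) : p x = p y -> exists g, act g x = y.
Proof. by move/eqmodP/asboolP. Qed.

Lemma orbit_proj_act (g : G) (x : X) : p (act g x) = p x.
Proof. by apply/esym/eqmodP/asboolP; exists g. Qed.

Lemma orbit_proj_invariant : ginvariant (pi_action act R) (pi_mor R p).
Proof.
move=> g; split=> [x|x y a]; first exact: orbit_proj_act.
have [b ->] := pi_hom_repr a.
rewrite /= /pi_hom !pi_mapE; apply: arrow_pclass => t /=.
exact: orbit_proj_act.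
Qed.

Hypothesis path_lift : path_lifting R p.
Hypothesis local_lift : forall x : X, exists U : set X,
  [/\ open U, U x &
      forall a b : continuousType I X,
        (forall t, U (a t)) -> (forall t, U (b t)) ->
        a zero = x -> b zero = x ->
        homotopic_rel (p \o a) (p \o b) ->
        exists2 g : G, stabiliser act x g & homotopic_rel (act g \o a) b].

Variables (C : groupoid) (phi : gmor (fundamental_groupoid R X) C).
Hypothesis phi_inv : ginvariant (pi_action act R) phi.

Local Notation Phi a := (arrow (gmor_hom phi (pi_hom a))).

Lemma Phi_homotopic (x y x' y' : X) (a : {path I from x to y in X})
    (b : {path I from x' to y' in X}) : homotopic_rel a b -> Phi a = Phi b.
Proof. by move=> ab; apply: arrow_gmor; exact: arrow_homotopic. Qed.

Lemma Phi_act (g : G) (x y : X) (a : {path I from x to y in X}) :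
  Phi (Defs.pmap (tact_map act g) a) = Phi a.
Proof.
have [_ /(_ x y (pi_hom a)) <-] := phi_inv g.
by congr (arrow (gmor_hom _ _)); rewrite /= /pi_hom pi_mapE.
Qed.

Lemma phi_orbit (x y : X) : p x = p y -> phi x = phi y.
Proof. by move=> /orbit_projP[g <-]; rewrite -[LHS](phi_inv g).1. Qed.

(** The group element provided by the local condition is absorbed by the invariance of [phi]. The
    starting points are kept as variables equal to [x] because those of composite paths are rarely
    convertible to it. *)
Lemma Phi_local (x : X) (U : set X) :
  (forall a b : continuousType I X,
    (forall t, U (a t)) -> (forall t, U (b t)) -> a zero = x -> b zero = x ->
    homotopic_rel (p \o a) (p \o b) ->
    exists2 g : G, stabiliser act x g & homotopic_rel (act g \o a) b) ->
  forall (y z y' z' : X) (a : {path I from y to z in X})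
    (b : {path I from y' to z' in X}),
  y = x -> y' = x -> (forall t, U (a t)) -> (forall t, U (b t)) ->
  homotopic_rel (p \o a) (p \o b) -> Phi a = Phi b.
Proof.
move=> Uloc y z y' z' a b yx y'x Ua Ub ab.
have [g _ gab] :=
  Uloc a b Ua Ub (etrans (path_src a) yx) (etrans (path_src b) y'x) ab.
by rewrite -(Phi_act g); exact: Phi_homotopic.
Qed.

(** Pulling [phi] back along [a] and [b] gives two morphisms on the groupoid of the interval.
    Agreement on segments is transitive and symmetric, and it holds locally, so it holds on the
    whole interval. *)
Lemma Phi_lift (x y x' y' : X) (a : {path I from x to y in X})
    (b : {path I from x' to y' in X}) : p \o a =1 p \o b -> Phi a = Phi b.
Proof.
move=> ab.
pose A := gmor_compm phi (pi_mor R a); pose B := gmor_compm phi (pi_mor R b).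
pose E (s t : I) :=
  arrow (gmor_hom A (pi_hom (seg s t))) = arrow (gmor_hom B (pi_hom (seg s t))).
have AE (s t : I) : arrow (gmor_hom A (pi_hom (seg s t))) = Phi (Defs.pmap a (seg s t)).
  by rewrite /= /pi_hom pi_mapE.
have BE (s t : I) : arrow (gmor_hom B (pi_hom (seg s t))) = Phi (Defs.pmap b (seg s t)).
  by rewrite /= /pi_hom pi_mapE.
have Etr r s t : E r s -> E s t -> E r t.
  by move=> rs st; rewrite /E -!(gcomp_seg r s t) !gmor_comp; exact: arrow_gcomp.
have Esym s t : E s t -> E t s.
  by move=> st; rewrite /E -!(ginv_seg s t) !gmor_inv; exact: arrow_ginv.
have Eloc s : nbhs s [set t | E s t /\ E t s].
  suff : nbhs s [set t | E s t] by apply: filterS => t st; split=> //; exact: Esym.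
  (* The translate of [a] by [g] meets [b] at parameter [s], so both can be compared inside one good
     neighbourhood of [b s]. *)
  have [g gas] := orbit_projP (ab s).
  have [U [oU Ux Uloc]] := local_lift (b s).
  have h1 : nbhs s [set t | U (act g (a t))].
    apply: (comp_cont (@tact_continuous _ _ act g) (@cts_fun _ _ a)).
    by rewrite gas; exact: open_nbhs_nbhs.
  have h2 : nbhs s [set t | U (b t)].
    by apply: (@cts_fun _ _ b); exact: open_nbhs_nbhs.
  have [e e0 eU] := nbhs_uval (filterI h1 h2).
  apply: filterS (near_uval s e0) => t /= st; rewrite /E AE BE.
  rewrite -(Phi_act g).
  have sU r : U (act g (a (seg s t r))) /\ U (b (seg s t r)).
    by apply: eU; apply: seg_near => //; rewrite subrr normr0.
  apply: (Phi_local Uloc) => // [r|r|].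
  - exact: (sU r).1.
  - exact: (sU r).2.
  - have -> :
      p \o Defs.pmap (tact_map act g) (Defs.pmap a (seg s t)) =
      p \o Defs.pmap b (seg s t).
      by apply/funext => r; exact: etrans (orbit_proj_act _ _) (ab _).
    apply: homotopic_refl; apply: comp_cont; first exact: cts_fun.
    exact: cts_fun.
have := unit_interval_chain Etr Eloc zero one; rewrite /E AE BE => E01.
have seg01 (z z' : X) (c : {path I from z to z' in X}) :
    Phi (Defs.pmap c (seg zero one)) = Phi c.
  apply: Phi_homotopic; apply: (@homotopic_reparam _ _ c _ id) => //.
  - exact: cts_fun.
  - exact: cts_fun.
  - exact: id_cont.
  - by rewrite path_zero.
  - by rewrite path_one.
by rewrite -(seg01 _ _ a) -(seg01 _ _ b).
Qed.

Definition phi_ob (y : Y) : C := phi (repr y).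

Lemma phi_obE (x : X) : phi_ob (p x) = phi x.
Proof. by apply: phi_orbit; exact: reprK. Qed.

Lemma lift_exists (y y' : Y) (u : {path I from y to y' in Y}) :
  exists (x x' : X) (a : {path I from x to x' in X}), p \o a =1 u.
Proof.
have [a au] := path_lift u.
exists (a zero), (a one), (mk_path (@cts_fun _ _ a) erefl erefl) => t.
by rewrite -au.
Qed.

(** The value of one lift is transported to the end points prescribed by [phi_ob]; [Phi_lift] shows
    that it serves every other lift. *)
Lemma phi_path_exists (y y' : Y) (u : {path I from y to y' in Y}) :
  exists h : @ghom C (phi_ob y) (phi_ob y'),
    forall (x x' : X) (a : {path I from x to x' in X}),
      p \o a =1 u -> Phi a = arrow h.
Proof.
have [x [x' [a au]]] := lift_exists u.
have yx : phi x = phi_ob y.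
  by rewrite -phi_obE -(path_src u) -(au zero) /= path_zero.
have yx' : phi x' = phi_ob y'.
  by rewrite -phi_obE -(path_tgt u) -(au one) /= path_one.
have [h ah] : exists h : @ghom C (phi_ob y) (phi_ob y'), Phi a = arrow h.
  by case: _ / yx; case: _ / yx'; exists (gmor_hom phi (pi_hom a)).
exists h => z z' b bu; rewrite -ah; apply: Phi_lift => t.
by rewrite bu au.
Qed.

Definition phi_path (y y' : Y) (u : {path I from y to y' in Y}) :
  @ghom C (phi_ob y) (phi_ob y') := projT1 (cid (phi_path_exists u)).

Lemma phi_pathE (y y' : Y) (u : {path I from y to y' in Y}) (x x' : X)
    (a : {path I from x to x' in X}) :
  p \o a =1 u -> Phi a = arrow (phi_path u).
Proof. by rewrite /phi_path; case: cid => h /= uh; exact: uh. Qed.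

Lemma phi_path_ext (y y' z z' : Y) (u : {path I from y to y' in Y})
    (v : {path I from z to z' in Y}) :
  u =1 v -> arrow (phi_path u) = arrow (phi_path v).
Proof.
move=> uv; have [x [x' [a au]]] := lift_exists u.
rewrite -(phi_pathE au); apply: phi_pathE => t; by rewrite au uv.
Qed.

Lemma phi_path_cat (y y' y'' : Y) (u : {path I from y to y' in Y})
    (v : {path I from y' to y'' in Y}) :
  phi_path (pcat u v) = gcomp (phi_path u) (phi_path v).
Proof.
apply: arrow_inj.
have [x [x' [a au]]] := lift_exists u; have [z [z' [b bv]]] := lift_exists v.
(* The two lifts need not be composable: the second is translated to start where the first ends. *)
have [g gz] : exists g, act g z = x'.
  apply: orbit_projP; rewrite -(path_src b) -(path_tgt a).
  by rewrite [LHS]bv [RHS]au path_zero path_one.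
case: _ / gz in a au *.
pose gb := Defs.pmap (tact_map act g) b.
have gbv : p \o gb =1 v by move=> t; rewrite -bv; exact: orbit_proj_act.
rewrite -(@phi_pathE _ _ (pcat u v) _ _ (pcat a gb)) => [|t]; last first.
  rewrite /= /pcat /mk_path /path_cat.
  by case: ifP => _; [exact: au|exact: gbv].
rewrite pi_hom_cat gmor_comp.
by apply: arrow_gcomp; exact: phi_pathE.
Qed.

Lemma phi_path_cst (y y' : Y) (u : {path I from y to y' in Y}) :
  (forall t, u t = y) -> arrow (phi_path u) = arrow (gid (phi_ob y)).
Proof.
move=> uy; rewrite -(@phi_pathE _ _ u _ _ (pconst R (repr y))) => [|t].
  by rewrite [pi_hom _]/(@gid (fundamental_groupoid R X) _) gmor_id.
by rewrite uy; exact: reprK.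
Qed.

Lemma phi_path_rev (y y' : Y) (u : {path I from y to y' in Y}) :
  phi_path (Defs.prev u) = ginv (phi_path u).
Proof.
have [x [x' [a au]]] := lift_exists u.
apply: arrow_inj; rewrite -(@phi_pathE _ _ _ _ _ (Defs.prev a)) => [|t].
  by rewrite pi_hom_rev gmor_inv; apply: arrow_ginv; exact: phi_pathE.
exact: au.
Qed.

(** A lift of [u] carries the homotopy between [c] and [d] in the interval to one in [X]. *)
Lemma phi_path_along (u : continuousType I Y) (s t : I)
    (c d : {path I from s to t in I}) :
  phi_path (Defs.pmap u c) = phi_path (Defs.pmap u d).
Proof.
have [a au] := path_lift u.
apply: arrow_inj.
rewrite -(@phi_pathE _ _ (Defs.pmap u c) _ _ (Defs.pmap a c)) => [|r];
  last by rewrite /= -au.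
rewrite -(@phi_pathE _ _ (Defs.pmap u d) _ _ (Defs.pmap a d)) => [|r];
  last by rewrite /= -au.
apply: Phi_homotopic; apply: homotopic_comp; first exact: cts_fun.
by apply/pclassP; exact: pi_hom_unit_interval.
Qed.

(** * Invariance under a homotopy on the square *)

Section Square.
Variable H : continuousType (I * I)%type Y.

(** An analogue of parallel transport along paths of the square; its local path independence is what
    has to be shown. *)
Definition holonomy (z w : I * I) (l : {path I from z to w in (I * I)%type}) :
  @ghom C (phi_ob (H z)) (phi_ob (H w)) := phi_path (Defs.pmap H l).

Lemma holonomy_cat (x y z : I * I) (k : {path I from x to y in (I * I)%type})
    (l : {path I from y to z in (I * I)%type}) :
  holonomy (pcat k l) = gcomp (holonomy k) (holonomy l).
Proof.
rewrite -phi_path_cat; congr phi_path; apply/path_eqP => t.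
by rewrite /= /pcat /Defs.pmap /mk_path /= /path_cat; case: ifP.
Qed.

Lemma holonomy_rev (x y : I * I) (l : {path I from x to y in (I * I)%type}) :
  holonomy (Defs.prev l) = ginv (holonomy l).
Proof. by rewrite -phi_path_rev; congr phi_path; apply/path_eqP. Qed.

Lemma holonomy_along (u : continuousType I (I * I)%type) (r s t : I) :
  holonomy (Defs.pmap u (seg r t)) =
  gcomp (holonomy (Defs.pmap u (seg r s))) (holonomy (Defs.pmap u (seg s t))).
Proof.
rewrite -holonomy_cat.
have E (c : {path I from r to t in I}) :
    Defs.pmap H (Defs.pmap u c) = Defs.pmap (H \o u) c by exact/path_eqP.
transitivity (holonomy (Defs.pmap u (pcat (seg r s) (seg s t)))).
  by rewrite /holonomy !E; exact: (phi_path_along [the continuousType _ _ of H \o u]).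
congr holonomy; apply/path_eqP => q.
by rewrite /= /pcat /Defs.pmap /mk_path /= /path_cat; case: ifP.
Qed.

Lemma holonomy_small_loops (z : I * I)
    (l : nat -> {path I from z to z in (I * I)%type}) :
  (forall U, nbhs z U -> exists m, forall k t, (m <= k)%N -> U (l k t)) ->
  exists n, holonomy (l n) = gid (phi_ob (H z)).
Proof.
move=> lz; pose w := mkcts (infinite_cat_continuous lz).
have [a aw] := path_lift (H \o w).
have paw t : p (a t) = H (w t) by rewrite -[LHS]/((p \o a) t) aw.
have [U [oU Ux Uloc]] := local_lift (a zero).
have : nbhs zero [set t | U (a t)].
  by apply: (@cts_fun _ _ a); exact: open_nbhs_nbhs.
move=> /nbhs_uval[e e0 eU].
(* Halving [e] makes the bound strict at the end point [s n]. *)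
have [n ne] : exists n, (2 : R) ^- n <= e / 2.
  by apply: exists_dyadic_le; lra.
exists n; pose s k : I := clamp ((2 : R) ^- k).
have sE k : uval (s k) = 2 ^- k by rewrite clamp_id// dyadic_bound.
have Ua k : (n <= k)%N -> forall t, U (a (seg zero (s k) t)).
  move=> nk t; apply/eU/seg_near; rewrite uval0; first by rewrite subrr normr0.
  rewrite subr0 ger0_norm sE; last by case/andP: (dyadic_bound R k).
  by apply: le_lt_trans (dyadic_anti R nk) _; lra.
have wl t : w (seg (s n.+1) (s n) t) = l n t by exact: infinite_cat_seg.
have ws1 : w (s n.+1) = z by rewrite -(path_src (l n)) -wl path_zero.
have ws0 : w (s n) = z by rewrite -(path_tgt (l n)) -wl path_one.
pose A := gmor_compm phi (pi_mor R a).
have AE (c d : I) : arrow (gmor_hom A (pi_hom (seg c d))) = Phi (Defs.pmap a (seg c d)).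
  by rewrite /= /pi_hom pi_mapE.
(* Up to [s n.+1] and up to [s n], the path [w] ends at [z]. These two paths of the square are
   homotopic, so the corresponding parts of [a] have homotopic projections while staying in [U]. *)
have : arrow (gcomp (gmor_hom A (pi_hom (seg zero (s n.+1))))
                    (gmor_hom A (pi_hom (seg (s n.+1) (s n))))) =
       arrow (gmor_hom A (pi_hom (seg zero (s n.+1)))).
  rewrite -gmor_comp gcomp_seg !AE; apply: (Phi_local Uloc) => //.
  - exact: Ua.
  - exact: Ua.
  have E k : p \o Defs.pmap a (seg zero (s k)) = H \o (w \o seg zero (s k)).
    by apply/funext => t; exact: paw.
  rewrite !E; apply: homotopic_comp; first exact: cts_fun.
  apply: homotopic_square; rewrite /= ?path_zero ?path_one ?ws0 ?ws1 //.
  - exact: cts_fun.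
  - exact: cts_fun.
(* After cancellation there remains the part of [a] between [s n.+1] and [s n], which lifts the
   image of [l n]. *)
move=> /arrow_gcomp_fix; rewrite AE (@phi_pathE _ _ (Defs.pmap H (l n))).
  move=> E; apply: arrow_inj; rewrite [LHS]E; apply: arrow_gid.
  by rewrite /= -phi_obE paw ws1.
by move=> t; rewrite /= -wl; exact: paw.
Qed.

Lemma holonomy_box (z : I * I) : exists2 e : R, 0 < e &
  forall (w w' : I * I) (k l : {path I from w to w' in (I * I)%type}),
    (forall t, box z e (k t)) -> (forall t, box z e (l t)) ->
    holonomy k = holonomy l.
Proof.
(* Loops suffice: [k] followed by the reverse of [l] is a loop in the same box. *)
suff [e e0 eH] : exists2 e : R, 0 < e &
    forall (w : I * I) (l : {path I from w to w in (I * I)%type}),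
    (forall t, box z e (l t)) -> holonomy l = gid (phi_ob (H w)).
  exists e => // w w' k l kz lz.
  apply: (@gcompKr _ _ _ _ (ginv (holonomy l))).
  rewrite gcompVr -holonomy_rev -holonomy_cat; apply: eH => t.
  by rewrite /= /pcat /Defs.prev /mk_path /= /path_cat /path_rev; case: ifP.
apply: contrapT => noe.
have bad n : exists l : {path I from z to z in (I * I)%type},
    (forall t, box z (2 ^- n) (l t)) /\ holonomy l <> gid (phi_ob (H z)).
  apply: contrapT => nol; apply: noe; exists (2 ^- n).
    by rewrite invr_gt0 exprn_gt0.
  move=> w l lz; apply: contrapT => lw; apply: nol.
  (* Conjugation by a straight segment moves the base point to [z]; convexity keeps the loop in the
     box, and the value stays nontrivial. *)
  exists (pcat (pcat (seg2 z w) l) (Defs.prev (seg2 z w))); split.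
    have zw : box z (2 ^- n) w by rewrite -(path_src l).
    have e0 : (0 : R) < 2 ^- n by rewrite invr_gt0 exprn_gt0.
    move=> t; rewrite /= /pcat /Defs.prev /mk_path /= /path_cat /path_rev.
    have sz r := seg2_box r e0 zw.
    by case: ifP => _; [case: ifP => _ //|]; exact: sz.
  rewrite !holonomy_cat holonomy_rev => /ginv_gcomp1 E; apply: lw.
  apply: (@gcompKl _ _ _ _ (holonomy (seg2 z w))).
  apply: (@gcompKr _ _ _ _ (ginv (holonomy (seg2 z w)))).
  by rewrite gcomp1r gcompVr {1}E gcompVr.
have [l lP] := choice bad.
have [|n] := @holonomy_small_loops z l; last exact: (lP n).2.
move=> U /nbhs_box[e e0 eU]; have [m me] := exists_dyadic_le e0.
exists m => k t mk; apply: eU; have [h1 h2] := (lP k).1 t.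
by split; [apply: lt_le_trans h1 _|apply: lt_le_trans h2 _];
  apply: le_trans (dyadic_anti R mk) me.
Qed.

Definition rect_commutes (t t' s s' : I) : Prop :=
  gcomp (holonomy (hseg t t' s)) (holonomy (vseg t' s s')) =
  gcomp (holonomy (vseg t s s')) (holonomy (hseg t t' s')).

Lemma rect_commutes_trans (t1 t2 t3 s s' : I) :
  rect_commutes t1 t2 s s' -> rect_commutes t2 t3 s s' ->
  rect_commutes t1 t3 s s'.
Proof.
rewrite /rect_commutes => r12 r23.
have hE q : holonomy (hseg t1 t3 q) =
    gcomp (holonomy (hseg t1 t2 q)) (holonomy (hseg t2 t3 q)).
  exact: (@holonomy_along (mkcts (@row_continuous R q)) t1 t2 t3).
by rewrite !hE -gcompA r23 !gcompA r12.
Qed.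

(** With [s] fixed, the chain argument runs along the horizontal direction. Gluing two rectangles
    intersects two neighbourhoods of [s], and a small rectangle commutes by [holonomy_box]. *)
Lemma rect_commutes_near (s : I) :
  nbhs s [set s' | rect_commutes zero one s s'].
Proof.
pose E t t' := nbhs s [set s' | rect_commutes t t' s s'].
suff : E zero one by [].
apply: unit_interval_chain => [t1 t2 t3 h12 h23|t].
  apply: filterS (filterI h12 h23) => s' [] /=.
  exact: rect_commutes_trans.
have [e e0 eH] := holonomy_box (t, s).
have near_rect t1 t2 : `|uval t1 - uval t| < e -> `|uval t2 - uval t| < e ->
    E t1 t2.
  move=> h1 h2; apply: filterS (near_uval s e0) => s' /= hs'.
  have hs : `|uval s - uval s| < e by rewrite subrr normr0.
  rewrite /rect_commutes -!holonomy_cat; apply: eH => q;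
    rewrite /= /pcat /mk_path /= /path_cat; case: ifP => _; split => //=;
    exact: seg_near.
have tt : `|uval t - uval t| < e by rewrite subrr normr0.
by apply: filterS (near_uval t e0) => t' /= tt'; split; exact: near_rect.
Qed.

(** The vertical sides are sent to constant paths, so a commuting rectangle identifies its two
    horizontal sides; the chain argument then runs vertically. *)
Lemma holonomy_rows (y y' : Y) :
  (forall s, H (zero, s) = y) -> (forall s, H (one, s) = y') ->
  forall s s', arrow (holonomy (hseg zero one s)) =
               arrow (holonomy (hseg zero one s')).
Proof.
move=> H0 H1; apply: unit_interval_chain => [r s s' -> //|s].
suff : nbhs s [set s' | arrow (holonomy (hseg zero one s)) =
                        arrow (holonomy (hseg zero one s'))].
  by apply: filterS => s' /= ->.
apply: filterS (rect_commutes_near s) => s' /= rss'.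
have v1 t : (forall q, H (t, q) = H (t, s)) ->
    arrow (holonomy (vseg t s s')) = arrow (gid (phi_ob (H (t, s)))).
  by move=> Ht; apply: phi_path_cst => q; exact: Ht.
have h0 := v1 zero (fun q => etrans (H0 q) (esym (H0 s))).
have h1 := v1 one (fun q => etrans (H1 q) (esym (H1 s))).
move/(congr1 (@arrow C _ _)) : rss'.
have e0 : phi_ob (H (zero, s)) = phi_ob (H (zero, s')) by rewrite !H0.
rewrite (arrow_gcomp (erefl _) h1) gcomp1r => ->.
by rewrite (arrow_gcomp (etrans h0 (arrow_gid e0)) (erefl _)) gcomp1l.
Qed.

End Square.

(** The paths [u] and [v] are the bottom and top rows of the homotopy. *)
Lemma phi_path_homotopic (y y' : Y) (u v : {path I from y to y' in Y}) :
  homotopic_rel u v -> phi_path u = phi_path v.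
Proof.
move=> [H [cH H01 H0 H1]]; apply: arrow_inj.
have row (w : {path I from y to y' in Y}) s : (forall t, H (t, s) = w t) ->
    arrow (holonomy (mkcts cH) (hseg zero one s)) = arrow (phi_path w).
  move=> ws; apply: phi_path_ext => t.
  by rewrite -ws -[LHS]/(H (seg zero one t, s)) seg01.
rewrite -(row u zero (fun t => (H01 t).1)) -(row v one (fun t => (H01 t).2)).
exact: (@holonomy_rows (mkcts cH) _ _ H0 H1).
Qed.

(** * The factorisation through the orbit space and its uniqueness *)

Definition phi_hom (y y' : Y) (c : @ghom (fundamental_groupoid R Y) y y') :
  @ghom C (phi_ob y) (phi_ob y') := phi_path (repr (c : path_class R y y')).

Lemma phi_homE (y y' : Y) (u : {path I from y to y' in Y}) :
  phi_hom (pi_hom u) = phi_path u.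
Proof. by apply: phi_path_homotopic; exact: repr_pclass. Qed.

Lemma phi_hom_id (y : Y) :
  phi_hom (@gid (fundamental_groupoid R Y) y) = gid (phi_ob y).
Proof.
apply: arrow_inj; rewrite -[phi_hom _]/(phi_hom (pi_hom (pconst R y))) phi_homE.
exact: phi_path_cst.
Qed.

Lemma phi_hom_comp (x y z : Y) (a : @ghom (fundamental_groupoid R Y) x y)
    (b : @ghom (fundamental_groupoid R Y) y z) :
  phi_hom (gcomp a b) = gcomp (phi_hom a) (phi_hom b).
Proof.
have [u ->] := pi_hom_repr a; have [v ->] := pi_hom_repr b.
by rewrite -pi_hom_cat !phi_homE phi_path_cat.
Qed.

Definition orbit_factor : gmor (fundamental_groupoid R Y) C :=
  @Gmor (fundamental_groupoid R Y) C phi_ob phi_hom phi_hom_id phi_hom_comp.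

Lemma orbit_factorE : gmor_compm orbit_factor (pi_mor R p) = phi.
Proof.
apply: gmor_eq => x y a; have [b ->] := pi_hom_repr a.
by rewrite /= /pi_hom pi_mapE [phi_hom _]phi_homE; exact/esym/phi_pathE.
Qed.

(** By path lifting every arrow over the orbit space is the image of an arrow over [X], so the
    composite determines the factor. *)
Lemma orbit_factor_unique (psi psi' : gmor (fundamental_groupoid R Y) C) :
  gmor_compm psi (pi_mor R p) = gmor_compm psi' (pi_mor R p) -> psi = psi'.
Proof.
move=> pp; apply: gmor_eq => y y' c; have [u ->] := pi_hom_repr c.
have [x [x' [a au]]] := lift_exists u.
have E (ps : gmor (fundamental_groupoid R Y) C) :
    arrow (gmor_hom ps (pi_hom u)) =
    arrow (gmor_hom (gmor_compm ps (pi_mor R p)) (pi_hom a)).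
  rewrite /= /pi_hom pi_mapE; apply: arrow_gmor.
  by apply: arrow_pclass => t; rewrite -au.
by rewrite (E psi) (E psi') pp.
Qed.

End OrbitGroupoid.

Theorem proposition1p8 (R : realType) (G : groupType) (X : topologicalType)
    (act : top_action G X)
    (path_lift : path_lifting R (orbit_proj act))
    (good_nbhd : forall x : X, exists U : set X,
      [/\ open U, U x,
          forall g : G, ~ stabiliser act x g -> U `&` (act g @` U) = set0 &
          forall a b : continuousType (unit_interval R) X,
            (forall t, U (a t)) -> (forall t, U (b t)) ->
            a zero = x -> b zero = x ->
            homotopic_rel (orbit_proj act \o a) (orbit_proj act \o b) ->
            exists2 g : G, stabiliser act x g & homotopic_rel (act g \o a) b]) :
  orbit_morphism (pi_action act R) (pi_mor R (orbit_proj act)).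
Proof.
have local_lift x : exists U : set X, [/\ open U, U x &
    forall a b : continuousType (unit_interval R) X,
      (forall t, U (a t)) -> (forall t, U (b t)) ->
      a zero = x -> b zero = x ->
      homotopic_rel (orbit_proj act \o a) (orbit_proj act \o b) ->
      exists2 g : G, stabiliser act x g & homotopic_rel (act g \o a) b].
  by have [U [oU Ux _ Uab]] := good_nbhd x; exists U.
split; first exact: orbit_proj_invariant.
move=> C phi phi_inv.
exists (orbit_factor path_lift local_lift phi_inv); split.
  exact: orbit_factorE.
move=> psi psiE; apply: (orbit_factor_unique path_lift).
by rewrite orbit_factorE.
Qed.
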